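(* Let $h:=\|\mathcal{K}_1\phi\|_{L^\infty(\omega)}\in(0,\infty)$, where $\phi\in L^p(\partial\Omega)$. Assume that there exists a constant $b\in(1,\infty)$ such that $\|\mathcal{K}_1K_2\|\le\left(1-\frac1b\right)/h$. Let $(\widetilde\eta^{(n)})_{n=0}^\infty$ be the sequence constructed by the iteration $$\widetilde\eta^{(n+1)}=\widetilde\eta^{(n)}-\mathcal{K}_1K_2\left(\left(\widetilde\eta^{(n)}-\widetilde\eta^{(n-1)}\right)\otimes\widetilde\eta^{(1)}\right),\qquad n\ge1,$$ with $\widetilde\eta^{(0)}\equiv0$, $\widetilde\eta^{(1)}=\mathcal{K}_1\phi$. Then this iteration admits a unique fixed-point $\widetilde\eta^*$. Furthermore, $$\left\|\widetilde\eta^{(n)}-\widetilde\eta^*\right\|_{L^\infty(\omega)}\le b\left\|\widetilde\eta^{(n+1)}-\widetilde\eta^{(n)}\right\|_{L^\infty(\omega)},\qquad n\ge0.$$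
   Context: Let $\Omega\subset\mathbb{R}^d$ ($d\ge2$) be a bounded domain, and $\omega\subset\Omega$ a closed subset with a finite (positive) distance separating $\partial\omega$ and $\partial\Omega$. Functions in $L^\infty(\omega)$ are regarded as functions on $\Omega$ supported in $\omega$. Let $D_0,\alpha_0,\beta>0$ be constants, $f$ a source term, and $\partial_\nu$ the outer normal derivative on $\partial\Omega$. Let $u_0$ solve $-D_0\Delta u_0+\alpha_0u_0=f$ in $\Omega$, $D_0\partial_\nu u_0+\beta u_0=0$ on $\partial\Omega$, and let $G(x,y)$ be the corresponding Green's function: $-D_0\Delta_x G(x,y)+\alpha_0G(x,y)=\delta(x-y)$ for $x\in\Omega$, with $D_0\partial_\nu G+\beta G=0$ for $x\in\partial\Omega$, $y\in\Omega$. Fix $1\le p\le\infty$. $K_1:L^\infty(\omega)\to L^p(\partial\Omega)$ is the bounded linear operator $(K_1\xi)(x)=\alpha_0\int_\Omega G(x,y)\xi(y)u_0(y)\,dy$, $x\in\partial\Omega$, and $K_2$ is the bilinear operator $$K_2(\xi_1\otimes\xi_2)(x)=-\alpha_0^2\int_\Omega\int_\Omega G(x,y_1)\xi_1(y_1)G(y_1,y_2)\xi_2(y_2)u_0(y_2)\,dy_1dy_2,\quad x\in\partial\Omega,$$ with values in $L^p(\partial\Omega)$. $\mathcal{K}_1=\mathcal{K}_{1,\alpha}:L^p(\partial\Omega)\to L^\infty(\omega)$ is a regularized pseudoinverse of $K_1$ (a bounded linear operator): a member of a family of regularization operators approximating the Moore-Penrose pseudoinverse $K_1^+$, in the sense that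 for some parameter choice $\alpha=\alpha(\delta,\phi^\delta)>0$ with $\limsup_{\delta\to0}\{\alpha(\delta,\phi^\delta):\phi^\delta\in L^p(\partial\Omega),\ \|\phi^\delta-\phi\|_{L^p(\partial\Omega)}\le\delta\}=0$ one has $\lim_{\delta\to0}\sup\{\|\mathcal{K}_{1,\alpha(\delta,\phi^\delta)}\phi^\delta-K_1^+\phi\|_{L^\infty(\omega)}:\phi^\delta\in L^p(\partial\Omega),\ \|\phi^\delta-\phi\|_{L^p(\partial\Omega)}\le\delta\}=0$ for all $\phi$ in the domain of $K_1^+$. It is not assumed that $\mathcal{K}_1K_1=I$. $\|\mathcal{K}_1K_2\|$ is the operator norm of the bilinear map $(\xi_1,\xi_2)\mapsto\mathcal{K}_1K_2(\xi_1\otimes\xi_2)$ from $L^\infty(\omega)\times L^\infty(\omega)$ to $L^\infty(\omega)$. Meaning of fixed-point: with the given initial values, summing the recursion shows that it is equivalent to the one-step iteration $\widetilde\eta^{(n+1)}=\widetilde\eta^{(1)}-\mathcal{K}_1K_2\left(\widetilde\eta^{(n)}\otimes\widetilde\eta^{(1)}\right)$, $n\ge0$; a fixed-point of the iteration is an element $\xi\in L^\infty(\omega)$ with $\xi=\widetilde\eta^{(1)}-\mathcal{K}_1K_2\left(\xi\otimes\widetilde\eta^{(1)}\right)$. *)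

(* Defs.v *)
From HB Require Import structures.
From mathcomp Require Import all_boot all_order all_algebra.
From mathcomp Require Import all_classical all_reals all_analysis.

Set Implicit Arguments.
Unset Strict Implicit.
Unset Printing Implicit Defensive.

Import Order.TTheory GRing.Theory Num.Theory.
Import numFieldTopology.Exports numFieldNormedType.Exports.

Local Open Scope classical_set_scope.
Local Open Scope ring_scope.

(* The norm that the library puts on ['rV[R]_d] is the sup norm: it gives the
   usual topology, but the metric notions below need the Euclidean norm. *)
Section Euclidean.
Context (R : realType) (d : nat).
Implicit Types (x y : 'rV[R]_d) (A : set 'rV[R]_d).

Definition dotp x y : R := \sum_(i < d) x 0 i * y 0 i.

Definition enorm x : R := Num.sqrt (dotp x x).

Definition ediam A : \bar R :=
  ereal_sup [set (enorm (z.1 - z.2))%:E | z in A `*` A].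

Definition boundary A : set 'rV[R]_d := closure A `\` interior A.

Definition bounded_domain A : Prop :=
  [/\ A !=set0, open A, connected A & bounded_set A].

Definition positive_distance A B : Prop :=
  exists2 r : R, 0 < r & forall x y, A x -> B y -> r <= enorm (x - y).

End Euclidean.

Section CoverOuterMeasure.
Context (R : realType) (T : pointedType).
Local Open Scope ereal_scope.

(* The outer measure generated by countable covers weighted by [tau], with the
   convention that the empty set has weight zero. *)
Definition gauge (tau : set T -> \bar R) (X : set T) : \bar R :=
  if `[< X = set0 >] then 0 else tau X.

Definition cover_outer (tau : set T -> \bar R) (A : set T) : \bar R :=
  ereal_inf [set \sum_(k <oo) gauge tau (F k) |
             F in [set F : (set T)^nat | A `<=` \bigcup_k F k]].

Section properties.
Variable tau : set T -> \bar R.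
Hypothesis tau_ge0 : forall X, 0 <= tau X.

Lemma gauge_ge0 X : 0 <= gauge tau X.
Proof. by rewrite /gauge; case: ifP. Qed.

Lemma gauge0 : gauge tau set0 = 0.
Proof. by rewrite /gauge; case: asboolP. Qed.

Lemma cover_outerE A :
  cover_outer tau A =
  mu_ext (gauge tau : set (g_sigma_algebraType [set: set T]) -> \bar R) A.
Proof.
congr ereal_inf; apply/seteqP; split => [_ [F AF <-]|_ [F [_ AF] <-]].
  by exists F => //; split => // i; exact: sub_sigma_algebra.
by exists F.
Qed.

Lemma cover_outer0 : cover_outer tau set0 = 0.
Proof. by rewrite cover_outerE mu_ext0// ?gauge0//; exact: gauge_ge0. Qed.

Lemma cover_outer_ge0 A : 0 <= cover_outer tau A.
Proof. by rewrite cover_outerE; apply: mu_ext_ge0; exact: gauge_ge0. Qed.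

Lemma le_cover_outer : {homo cover_outer tau : A B / A `<=` B >-> A <= B}.
Proof. by move=> A B AB; rewrite !cover_outerE; exact: le_mu_ext. Qed.

Lemma cover_outer_sigma_subadditive : sigma_subadditive (cover_outer tau).
Proof.
move=> F; rewrite cover_outerE; under eq_eseriesr do rewrite cover_outerE.
by apply: mu_ext_sigma_subadditive; exact: gauge_ge0.
Qed.

End properties.
End CoverOuterMeasure.

Section Lebesgue.
Context (R : realType) (d : nat).
Local Open Scope ereal_scope.
Implicit Types (X : set 'rV[R]_d).

Definition box (a b : 'rV[R]_d) : set 'rV[R]_d :=
  [set x | forall i, (a 0 i <= x 0 i <= b 0 i)%R].

(* The volume of a closed box; [+oo] on the sets that are not boxes. *)
Definition box_volume X : \bar R :=
  ereal_inf [set (\prod_(i < d) (z.2 0 i - z.1 0 i))%:E | z in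
    [set z : 'rV[R]_d * 'rV[R]_d |
      (forall i, (z.1 0 i <= z.2 0 i)%R) /\ X = box z.1 z.2]].

Lemma box_volume_ge0 X : 0 <= box_volume X.
Proof.
apply: le_ereal_inf_tmp => _ [z [zle _] <-].
by rewrite lee_fin; apply: prodr_ge0 => i _; rewrite subr_ge0.
Qed.

Definition lebesgue_outer : set 'rV[R]_d -> \bar R := cover_outer box_volume.

HB.instance Definition _ := isOuterMeasure.Build R 'rV[R]_d lebesgue_outer
  (cover_outer0 box_volume_ge0) (cover_outer_ge0 box_volume_ge0)
  (@le_cover_outer _ _ box_volume)
  (cover_outer_sigma_subadditive box_volume_ge0).

End Lebesgue.

Section Hausdorff.
Context (R : realType) (d s : nat).
Local Open Scope ereal_scope.
Implicit Types (X : set 'rV[R]_d).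

(* The volume of the [s]-dimensional Euclidean ball of diameter one: with this
   normalization [s]-dimensional Hausdorff measure is surface measure. *)
Definition hausdorff_const : R :=
  fine (lebesgue_outer [set x : 'rV[R]_s | (enorm x <= 2^-1)%R]).

Definition diam_power (delta : R) X : \bar R :=
  if ediam X <= delta%:E then (hausdorff_const * fine (ediam X) ^+ s)%:E
  else +oo.

Definition hausdorff_outer X : \bar R :=
  ereal_sup [set cover_outer (diam_power delta) X |
             delta in [set delta : R | (0 < delta)%R]].

Lemma diam_power_ge0 delta X : 0 <= diam_power delta X.
Proof.
rewrite /diam_power; case: ifP => // _; rewrite lee_fin mulr_ge0//.
  by rewrite fine_ge0// outer_measure_ge0.
rewrite exprn_ge0//; have [->|/set0P[x Xx]] := eqVneq X set0.
  by rewrite /ediam setX0 image_set0 ereal_sup0.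
rewrite fine_ge0//; apply: (@le_trans _ _ (enorm (x - x))%:E).
  by rewrite lee_fin sqrtr_ge0.
by apply: ereal_sup_ubound; exists (x, x).
Qed.

Lemma hausdorff_outer0 : hausdorff_outer set0 = 0.
Proof.
rewrite /hausdorff_outer (_ : [set _ | _ in _] = [set 0]) ?ereal_sup1//.
apply/seteqP; split => [_ [delta _ <-]|_ ->].
  exact: cover_outer0 (diam_power_ge0 _).
by exists 1%R; [exact: ltr01|exact: cover_outer0 (diam_power_ge0 _)].
Qed.

Lemma hausdorff_outer_ub delta X : (0 < delta)%R ->
  cover_outer (diam_power delta) X <= hausdorff_outer X.
Proof. by move=> d0; apply: ereal_sup_ubound; exists delta. Qed.

Lemma hausdorff_outer_ge0 X : 0 <= hausdorff_outer X.
Proof.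
apply: le_trans (hausdorff_outer_ub X ltr01).
exact: cover_outer_ge0 (diam_power_ge0 _) X.
Qed.

Lemma le_hausdorff_outer : {homo hausdorff_outer : A B / A `<=` B >-> A <= B}.
Proof.
move=> A B AB; apply: ge_ereal_sup => _ [delta d0 <-].
exact: le_trans (le_cover_outer _ AB) (hausdorff_outer_ub B d0).
Qed.

Lemma hausdorff_outer_sigma_subadditive : sigma_subadditive hausdorff_outer.
Proof.
move=> F; apply: ge_ereal_sup => _ [delta d0 <-].
apply: le_trans (cover_outer_sigma_subadditive (diam_power_ge0 delta) F) _.
apply: lee_nneseries => [i _ _|i _].
  exact: cover_outer_ge0 (diam_power_ge0 _) _.
exact: hausdorff_outer_ub.
Qed.

HB.instance Definition _ := isOuterMeasure.Build R 'rV[R]_d hausdorff_outer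
  hausdorff_outer0 hausdorff_outer_ge0 le_hausdorff_outer
  hausdorff_outer_sigma_subadditive.

End Hausdorff.

Section Trace.
Context (R : realType) (T : pointedType).
Variables (mu : {outer_measure set T -> \bar R}) (A : set T).
Local Open Scope ereal_scope.

(* [mu] restricted to [A]. Its Caratheodory measurable sets are, for a
   measurable [A], those whose intersection with [A] is [mu]-measurable: the
   complement of [A] is a null set, and functions on [A] are represented by
   functions on [T] considered almost everywhere. *)
Definition outer_on (X : set T) : \bar R := mu (X `&` A).

Lemma outer_on0 : outer_on set0 = 0.
Proof. by rewrite /outer_on set0I outer_measure0. Qed.

Lemma outer_on_ge0 X : 0 <= outer_on X.
Proof. exact: outer_measure_ge0. Qed.

Lemma le_outer_on : {homo outer_on : X Y / X `<=` Y >-> X <= Y}.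
Proof. by move=> X Y XY; apply: le_outer_measure; exact: setSI. Qed.

Lemma outer_on_sigma_subadditive : sigma_subadditive outer_on.
Proof.
by move=> F; rewrite /outer_on setI_bigcupl; exact: outer_measure_sigma_subadditive.
Qed.

HB.instance Definition _ := isOuterMeasure.Build R T outer_on
  outer_on0 outer_on_ge0 le_outer_on outer_on_sigma_subadditive.

End Trace.

Section MeasureOn.
Context (R : realType) (T : pointedType).
Variables (mu : {outer_measure set T -> \bar R}) (A : set T).

Definition space_on := caratheodory_type (outer_on mu A).
HB.instance Definition _ := Measurable.on space_on.

Definition measure_on : set space_on -> \bar R := outer_on mu A.
HB.instance Definition _ := isMeasure.Build _ space_on R measure_on
  (caratheodory_measure0 _) (@caratheodory_measure_ge0 _ _ _)
  (@caratheodory_measure_sigma_additive _ _ _).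

End MeasureOn.
Arguments measure_on {R T} mu A.

Section Measures.
Context (R : realType) (d : nat).
Implicit Types A : set 'rV[R]_d.

Definition vol A : {measure set (space_on (@lebesgue_outer R d) A) -> \bar R} :=
  measure_on (@lebesgue_outer R d) A.

Definition surf A :
    {measure set (space_on (@hausdorff_outer R d d.-1) A) -> \bar R} :=
  measure_on (@hausdorff_outer R d d.-1) A.

End Measures.

Section RobinProblem.
Context (R : realType) (d : nat).
Implicit Types (Omega K : set 'rV[R]_d) (phi u : 'rV[R]_d -> R).

Definition partial (i : 'I_d) phi : 'rV[R]_d -> R :=
  fun x => 'D_(delta_mx 0 i) phi x.

Definition laplacian phi : 'rV[R]_d -> R :=
  fun x => \sum_(i < d) partial i (partial i phi) x.

Definition smooth phi : Prop := forall s : seq 'I_d,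
  continuous (foldr partial phi s) /\
  forall (i : 'I_d) x, derivable (foldr partial phi s) x (delta_mx 0 i).

Definition test_function Omega phi : Prop :=
  smooth phi /\
  exists K, [/\ compact K, K `<=` Omega & forall x, ~ K x -> phi x = 0].

(* [nu] is the outer unit normal at the boundary point [x]: near [x], and up to
   cones of arbitrarily small aperture around the tangent hyperplane, [Omega]
   lies on the side of the hyperplane opposite to [nu]. *)
Definition outer_normal Omega (x nu : 'rV[R]_d) : Prop :=
  enorm nu = 1 /\
  forall e : R, 0 < e -> \forall y \near x,
    (dotp (y - x) nu < - e * enorm (y - x) -> Omega y) /\
    (dotp (y - x) nu > e * enorm (y - x) -> ~ Omega y).

Definition has_normal_derivative u (x nu : 'rV[R]_d) (l : R) : Prop :=
  (u x - u (x - t *: nu)) / t @[t --> 0^'+] --> l.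

(* The values of [u] on the boundary are those of the continuous extension of
   [u]; interior singularities (such as that of a Green's function at its pole)
   are not excluded. *)
Definition robin_condition (D0 beta : R) Omega u : Prop :=
  (exists K, [/\ compact K, K `<=` Omega &
                 {within closure Omega `\` K, continuous u}]) /\
  forall x nu, boundary Omega x -> outer_normal Omega x nu ->
    exists2 l, has_normal_derivative u x nu l & D0 * l + beta * u x = 0.

(* Source terms are distributions, given as functionals on test functions: a
   function [f] acts by [fun phi => \int[vol Omega]_x (f x * phi x)] and the
   Dirac mass at [y] by [fun phi => phi y]. *)
Definition source := ('rV[R]_d -> R) -> R.

(* - D0 Delta u + alpha0 u = f in Omega, in the sense of distributions. *)
Definition diffusion_equation (D0 alpha0 : R) Omega (f : source) u : Prop :=
  (forall K, compact K -> K `<=` Omega ->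
     (vol K).-integrable setT (EFin \o u)) /\
  forall phi, test_function Omega phi ->
    \int[vol Omega]_x (u x * (- D0 * laplacian phi x + alpha0 * phi x)) = f phi.

Definition robin_solution (D0 alpha0 beta : R) Omega (f : source) u : Prop :=
  diffusion_equation D0 alpha0 Omega f u /\ robin_condition D0 beta Omega u.

Definition green_function (D0 alpha0 beta : R) Omega
    (G : 'rV[R]_d -> 'rV[R]_d -> R) : Prop :=
  forall y, Omega y ->
    robin_solution D0 alpha0 beta Omega (fun phi => phi y) (G ^~ y).

End RobinProblem.

(* Elements of the spaces are functions, not classes of functions, so that all
   the equations between them are stated almost everywhere. *)
Notation Linfty A := (LfunType (vol A) (leey 1%E)).
Notation Lboundary A p1 := (LfunType (surf (boundary A)) p1).

Section Operators.
Context (R : realType).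

Definition Lp_norm d (T : measurableType d) (mu : {measure set T -> \bar R})
    (p : \bar R) (p1 : (1 <= p)%E) (f : LfunType mu p1) : R :=
  fine ('N[mu]_p[EFin \o f])%E.

Context d1 (T1 : measurableType d1) (mu : {measure set T1 -> \bar R}).
Context d2 (T2 : measurableType d2) (nu : {measure set T2 -> \bar R}).
Context (p q : \bar R) (p1 : (1 <= p)%E) (q1 : (1 <= q)%E).
Local Notation X := (LfunType mu p1).
Local Notation Y := (LfunType nu q1).

Definition bounded_linear (K : X -> Y) : Prop :=
  (forall (a : R) (f g : X), K (a *: f + g) = a *: K f + K g %[ae nu]) /\
  exists C : R, forall f, Lp_norm (K f) <= C * Lp_norm f.

Definition bilinear_norm (B : X -> X -> Y) : \bar R :=
  ereal_sup [set (Lp_norm (B z.1 z.2))%:E | z in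
    [set z : X * X | Lp_norm z.1 <= 1 /\ Lp_norm z.2 <= 1]].

Definition least_squares (K : X -> Y) (phi : Y) (xi : X) : Prop :=
  forall zeta, Lp_norm (K xi - phi) <= Lp_norm (K zeta - phi).

Definition best_approximate (K : X -> Y) (phi : Y) (xi : X) : Prop :=
  least_squares K phi xi /\
  forall zeta, least_squares K phi zeta -> Lp_norm xi <= Lp_norm zeta.

(* The graph of the Moore-Penrose pseudoinverse: [phi] is in its domain, and
   its value at [phi] is [xi], when [xi] is the least squares solution of
   minimal norm of [K xi = phi]. Outside Hilbert spaces such a solution need
   not be unique, and the domain consists of the [phi] for which it is. *)
Definition moore_penrose (K : X -> Y) (phi : Y) (xi : X) : Prop :=
  best_approximate K phi xi /\
  forall zeta, best_approximate K phi zeta -> zeta = xi %[ae mu].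

Definition noisy (phi : Y) (delta : R) : set Y :=
  [set psi | Lp_norm (psi - phi) <= delta].

(* As in the textbook definition of regularization operators, the parameter
   choice rule may depend on the exact datum [phi]. A family with one rule for
   all the [phi] is a special case; that stronger requirement cannot be met when
   [Y] is separable and the range of the pseudoinverse is not. *)
Definition regularizes (K : X -> Y) (Kreg : R -> Y -> X) : Prop :=
  forall phi xi, moore_penrose K phi xi ->
  exists alpha : R -> Y -> R,
    [/\ forall delta psi, 0 < delta -> 0 < alpha delta psi,
        ereal_sup [set (alpha delta psi)%:E | psi in noisy phi delta]
          @[delta --> 0^'+] --> 0%E &
        ereal_sup [set (Lp_norm (Kreg (alpha delta psi) psi - xi))%:E |
                   psi in noisy phi delta] @[delta --> 0^'+] --> 0%E].

End Operators.

Section BornOperators.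
Context (R : realType) (d : nat) (Omega omega : set 'rV[R]_d).
Context (p : \bar R) (p1 : (1 <= p)%E).
Variables (alpha0 : R) (G : 'rV[R]_d -> 'rV[R]_d -> R) (u0 : 'rV[R]_d -> R).

Definition ext0 (xi : Linfty omega) (y : 'rV[R]_d) : R :=
  if y \in omega then xi y else 0.

Definition K1_integrand (xi : Linfty omega) (x y : 'rV[R]_d) : R :=
  G x y * ext0 xi y * u0 y.

Definition K2_integrand (xi1 xi2 : Linfty omega) (x y1 y2 : 'rV[R]_d) : R :=
  G x y1 * ext0 xi1 y1 * G y1 y2 * ext0 xi2 y2 * u0 y2.

Definition is_K1 (K1 : Linfty omega -> Lboundary Omega p1) : Prop :=
  forall xi, \forall x \ae surf (boundary Omega),
    (vol Omega).-integrable setT (EFin \o K1_integrand xi x) /\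
    K1 xi x = alpha0 * \int[vol Omega]_y K1_integrand xi x y.

Definition is_K2 (K2 : Linfty omega -> Linfty omega -> Lboundary Omega p1) :
    Prop :=
  forall xi1 xi2, \forall x \ae surf (boundary Omega),
    [/\ \forall y1 \ae vol Omega,
          (vol Omega).-integrable setT (EFin \o K2_integrand xi1 xi2 x y1),
        (vol Omega).-integrable setT
          (fun y1 => (\int[vol Omega]_y2 K2_integrand xi1 xi2 x y1 y2)%:E) &
        K2 xi1 xi2 x = - alpha0 ^+ 2 *
          \int[vol Omega]_y1 \int[vol Omega]_y2 K2_integrand xi1 xi2 x y1 y2].

End BornOperators.

(* Main.v *)
(* Write [B] for the bilinear map [K1reg K2] and [x1] for the first iterate.
   The map [T x = x1 - B(x, x1)] is a contraction of factor [1 - 1/b], since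
   [x1] has norm [h] and [B] has norm at most [(1 - 1/b) / h]; the iteration
   telescopes to [x_(n+1) = T x_n]. Banach's theorem in the complete space
   L^oo gives the fixed point, and [|x_n - x| <= |x_n - x_(n+1)| + q |x_n - x|]
   with [1 - q = 1/b] gives the estimate. Every identity holds only almost
   everywhere, so [T] is handled through the seminorm alone. *)
Require Import Defs.
From mathcomp Require Import all_boot all_order all_algebra.
From mathcomp Require Import all_classical all_reals all_analysis.
From mathcomp Require Import measurable_realfun ess_sup_inf ring lra.

Set Implicit Arguments.
Unset Strict Implicit.
Unset Printing Implicit Defensive.

Import Order.TTheory GRing.Theory Num.Theory.
Import numFieldTopology.Exports numFieldNormedType.Exports.
Local Open Scope classical_set_scope.
Local Open Scope ring_scope.

(** * The seminorm on functions and equality almost everywhere *)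

Section Lp_norm_theory.
Context (R : realType) d (T : measurableType d).
Variable mu : {measure set T -> \bar R}.
Context (p : \bar R) (p1 : (1 <= p)%E).
Implicit Types f g : LfunType mu p1.

Lemma LfunDE f g x : (f + g) x = f x + g x. Proof. by []. Qed.

Lemma LfunBE f g x : (f - g) x = f x - g x. Proof. by []. Qed.

Lemma LfunZE a f x : (a *: f) x = a * f x. Proof. by []. Qed.

Lemma Lp_norm_ge0 f : 0 <= Lp_norm f.
Proof. by rewrite fine_ge0// Lnorm_ge0. Qed.

Lemma Lp_normD f g : Lp_norm (f + g) <= Lp_norm f + Lp_norm g.
Proof. exact: ler_LnormD. Qed.

Lemma Lp_normZ a f : Lp_norm (a *: f) = `|a| * Lp_norm f.
Proof.
apply/EFin_inj; rewrite EFinM /Lp_norm !finite_norm_fine.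
exact: (LnormZ f a).
Qed.

(** Elements are functions rather than classes, so this is what lets an almost everywhere identity
    be used inside a norm. *)
Lemma Lp_norm_ae f g : f = g %[ae mu] -> Lp_norm f = Lp_norm g.
Proof.
move=> fg; rewrite /Lp_norm; congr fine; rewrite unlock /Lnorm.
case: p p1 f g fg => [r|//|//] p1' f g fg.
  have mpow (u : LfunType mu p1') :
      measurable_fun setT (fun x => `|(EFin \o u) x| `^ r)%E.
    apply: (measurableT_comp (measurable_poweR r)).
    by apply: measurableT_comp => //; exact/measurable_EFinP.
  congr (_ `^ _)%E; apply: ae_eq_integral; [by []|exact: mpow|exact: mpow|].
  by apply: filterS fg => x /= /[apply] ->.
by case: ifP => // _; apply: eq_ess_sup; apply: filterS fg => x /= ->.
Qed.

Lemma Lp_normC f g : Lp_norm (f - g) = Lp_norm (g - f).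
Proof. by rewrite -opprB -scaleN1r Lp_normZ normrN1 mul1r. Qed.

Lemma Lp_normB f g h :
  Lp_norm (f - g) <= Lp_norm (f - h) + Lp_norm (h - g).
Proof. by rewrite -(subrKA h) Lp_normD. Qed.

Lemma Lp_norm_sub_ae f g : f = g %[ae mu] <-> Lp_norm (f - g) = 0.
Proof.
split=> [fg|/fine_Lnormr_eq0]; last first.
  by apply: filterS => x /[apply]; rewrite LfunBE => /subr0_eq.
rewrite (@Lp_norm_ae _ 0); first by rewrite -(scale0r 0) Lp_normZ normr0 mul0r.
by apply: filterS fg => x /[apply] fgx; rewrite LfunBE fgx subrr.
Qed.

Lemma le0_Lp_norm_sub_ae f g : Lp_norm (f - g) <= 0 -> f = g %[ae mu].
Proof.
by move=> fg; apply/Lp_norm_sub_ae/eqP; rewrite eq_le fg Lp_norm_ge0.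
Qed.

End Lp_norm_theory.

(** * Completeness of the essentially bounded functions and the contraction principle *)

Section Linfty_theory.
Context (R : realType) d (T : measurableType d).
Variable mu : {measure set T -> \bar R}.
Local Notation X := (LfunType mu (leey 1%E)).
Implicit Types f g : X.

Lemma ae_le_Linfty_norm f : \forall x \ae mu, `|f x| <= Lp_norm f.
Proof.
(* On a null space the norm is 0 by convention instead of an essential supremum, but there every
   property holds almost everywhere. *)
have [mu0|mu0] := ltP 0%E (mu setT); last first.
  by apply: measure0_ae; apply/eqP; rewrite -measure_le0.
have := ess_sup_ge mu (abse \o (EFin \o f)).
apply: filterS => x /=; rewrite -lee_fin /Lp_norm finite_norm_fine.
by rewrite unlock /Lnorm mu0.
Qed.

Lemma ae_le_Lnorm_infty (f : T -> R) c : 0 <= c ->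
  (\forall x \ae mu, `|f x| <= c) -> ('N[mu]_+oo[EFin \o f] <= c%:E)%E.
Proof.
move=> c0 fc; rewrite unlock /Lnorm; case: ifP; rewrite ?lee_fin// => _.
by apply/ess_supP; apply: filterS fc => x /=; rewrite lee_fin.
Qed.

Lemma Linfty_norm_le f c : 0 <= c ->
  (\forall x \ae mu, `|f x| <= c) -> Lp_norm f <= c.
Proof.
by move=> c0 fc; rewrite -lee_fin /Lp_norm finite_norm_fine ae_le_Lnorm_infty.
Qed.

(** Off one null set the sequence is uniformly Cauchy, so it converges pointwise there, and the
    uniform bounds pass to the limit. *)
Lemma Linfty_complete (u : nat -> X) :
  (forall e, 0 < e -> exists N, forall m n, (N <= m)%N -> (N <= n)%N ->
    Lp_norm (u m - u n) <= e) ->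
  exists g : X, forall e, 0 < e -> exists N, forall n, (N <= n)%N ->
    Lp_norm (u n - g) <= e.
Proof.
move=> u_cauchy.
(* The limit superior is defined and measurable everywhere, with no exceptional set to cut out;
   wherever the sequence converges, [g] is its limit. *)
pose g x := fine (limn_esup (fun n => (u n x)%:E)).
have mg : measurable_fun setT g.
  apply: measurableT_comp => //; apply: measurable_fun_limn_esup => n.
  exact/measurable_EFinP.
(* There are countably many pairs [(m, n)], so one null set serves them all. *)
have u_le : \forall x \ae mu, forall m n,
    `|u m x - u n x| <= Lp_norm (u m - u n).
  apply: ae_foralln => m; apply: ae_foralln => n.
  exact: ae_le_Linfty_norm (u m - u n).
have u_g e N : 0 <= e ->
    (forall m n, (N <= m)%N -> (N <= n)%N -> Lp_norm (u m - u n) <= e) ->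
    \forall x \ae mu, forall n, (N <= n)%N -> `|u n x - g x| <= e.
  move=> e0 uNe; apply: filterS u_le => x u_le n Nn.
  have ux : cvgn (fun n => u n x).
    apply/cauchy_cvgP/cauchy_exP => r r0.
    have [M uM] := u_cauchy _ (divr_gt0 r0 (ltr0Sn _ 1)).
    exists (u M x); exists M => // k /= Mk; rewrite /ball/=.
    rewrite (le_lt_trans (u_le M k))// (le_lt_trans (uM _ _ (leqnn M) Mk))//.
    by rewrite ltr_pdivrMr// ltr_pMr// ltr1n.
  have gx : g x = limn (fun n => u n x).
    have ux' : cvgn (fun n => (u n x)%:E) 
      by apply/cvg_ex; exists (limn (u ^~ x))%:E; apply: cvg_EFin => //;
        exact: nearW.
    by rewrite /g is_cvg_limn_esupE// EFin_lim.
  rewrite gx distrC ler_distl; apply/andP; split.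
    apply: limr_ge => //; exists N => // m /= Nm.
    by rewrite lerBlDr; have := le_trans (u_le n m) (uNe _ _ Nn Nm);
       rewrite ler_norml => /andP[_]; rewrite lerBlDl addrC.
  apply: limr_le => //; exists N => // m /= Nm.
  by have := le_trans (u_le m n) (uNe _ _ Nm Nn);
     rewrite ler_norml => /andP[_]; rewrite lerBlDl.
(* [g] stays within 1 of some [u N], hence is essentially bounded. *)
have g_fin : g \in Lfun mu +oo.
  apply/andP; split; first by rewrite inE.
  rewrite inE/= /finite_norm.
  have [N uN] := u_cauchy 1 ltr01.
  apply: (@le_lt_trans _ _ (Lp_norm (u N) + 1)%:E); last exact: ltry.
  apply: ae_le_Lnorm_infty; first by rewrite addr_ge0// Lp_norm_ge0.
  apply: filterS2 (ae_le_Linfty_norm (u N)) (u_g _ _ ler01 uN) => x uNx ugx.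
  rewrite -(subrKC (u N x) (g x)) (le_trans (ler_normD _ _))// lerD//.
  by rewrite distrC ugx.
exists (Lfun_Sub (leey 1%E) g_fin) => e e0.
have [N uN] := u_cauchy e e0; exists N => n Nn.
apply: Linfty_norm_le; first exact: ltW.
apply: filterS (u_g _ _ (ltW e0) uN) => x /(_ n Nn).
by rewrite LfunBE.
Qed.

(** Banach's argument run on norms only: they ignore null sets, so [u n.+1] may be replaced by
    [F (u n)] inside them although the two agree only almost everywhere. *)
Lemma Linfty_contraction (F : X -> X) (u : nat -> X) (q : R) :
  0 <= q < 1 ->
  (forall f g, Lp_norm (F f - F g) <= q * Lp_norm (f - g)) ->
  (forall n, u n.+1 = F (u n) %[ae mu]) ->
  exists g : X,
    [/\ g = F g %[ae mu],
        forall f, f = F f %[ae mu] -> f = g %[ae mu] &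
        forall n, (1 - q) * Lp_norm (u n - g) <= Lp_norm (u n.+1 - u n)].
Proof.
move=> /andP[q0 q1] Fq uF.
have q1' : 0 < 1 - q by rewrite subr_gt0.
have step f n : Lp_norm (u n.+1 - F f) <= q * Lp_norm (u n - f).
  apply: le_trans (Fq _ _); rewrite le_eqVlt; apply/orP; left; apply/eqP.
  apply: Lp_norm_ae; apply: filterS (uF n) => x /[apply] uFx.
  by rewrite !LfunBE uFx.
have stepS m n : Lp_norm (u m.+1 - u n.+1) <= q * Lp_norm (u m - u n).
  apply: le_trans (step (u n) m); rewrite le_eqVlt; apply/orP; left; apply/eqP.
  apply: Lp_norm_ae; apply: filterS (uF n) => x /[apply] uFx.
  by rewrite !LfunBE uFx.
pose D := Lp_norm (u 1%N - u 0%N).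
have D0 : 0 <= D by exact: Lp_norm_ge0.
have geo n : Lp_norm (u n.+1 - u n) <= q ^+ n * D.
  elim: n => [|n IH]; first by rewrite expr0 mul1r.
  by rewrite (le_trans (stepS _ _))// exprS -mulrA ler_wpM2l.
(* With [D_n] the norm of [u n.+1 - u n], passing through [u n.+1] bounds the left side by
   [D_(n+1) + (1 - q) D_n], and [D_(n+1) <= q D_n] closes the induction on [k], with [n] kept
   general. *)
have tail k n :
    (1 - q) * Lp_norm (u (n + k)%N - u n) <= Lp_norm (u n.+1 - u n).
  elim: k n => [|k IH] n.
    by rewrite addn0 subrr -(scale0r 0) Lp_normZ normr0 mul0r mulr0 Lp_norm_ge0.
  rewrite addnS -addSn.
  have := Lp_normB (u (n.+1 + k)%N) (u n) (u n.+1).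
  have := IH n.+1; have := stepS n.+1 n; nra.
have u_cauchy e : 0 < e -> exists N, forall m n, (N <= m)%N -> (N <= n)%N ->
    Lp_norm (u m - u n) <= e.
  move=> e0.
  have : (fun n => q ^+ n * D) @ \oo --> 0 * D.
    by apply: cvgMl; apply: cvg_expr; rewrite ger0_norm.
  (* The factor [1 - q] cancels the one in [tail]; the half leaves room to compare [u m] and [u n]
     through [u N]. *)
  rewrite mul0r => /cvgrPdist_le /(_ ((1 - q) * (e / 2))) [].
    by rewrite mulr_gt0// divr_gt0.
  move=> N _ NP; exists N.
  have uN m : (N <= m)%N -> Lp_norm (u m - u N) <= e / 2.
    move=> Nm; rewrite -(ler_pM2l q1') -(subnKC Nm) (le_trans (tail _ _))//.
    rewrite (le_trans (geo _))//.
    have := NP N (leqnn N); rewrite /= sub0r normrN ger0_norm//.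
    by rewrite mulr_ge0// exprn_ge0.
  move=> m n Nm Nn; rewrite (le_trans (Lp_normB _ _ (u N)))//.
  by rewrite [e]splitr lerD// ?uN// Lp_normC uN.
have [g ug] := Linfty_complete u_cauchy; exists g.
(* Both [g] and [F g] are within [e / 2] of [u N.+1] for large [N], the latter because [F] shrinks
   the distance from [u N] to [g]. *)
have Fg : g = F g %[ae mu].
  apply: le0_Lp_norm_sub_ae; apply/ler_addgt0Pl => e e0; rewrite addr0.
  have [N uN] := ug (e / 2) (divr_gt0 e0 (ltr0Sn _ 1)).
  rewrite (le_trans (Lp_normB _ _ (u N.+1)))// [leRHS]splitr lerD//.
    by rewrite Lp_normC uN.
  rewrite (le_trans (step g N))//.
  have := uN N (leqnn N); have := Lp_norm_ge0 (u N - g); nra.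
split=> // [f Ff|n].
- apply: le0_Lp_norm_sub_ae.
  have fgE : Lp_norm (f - g) = Lp_norm (F f - F g).
    apply: Lp_norm_ae; apply: filterS2 Ff Fg => x fx gx ?.
    by rewrite !LfunBE fx ?gx.
  by rewrite -(pmulr_rle0 _ q1') mulrBl mul1r subr_le0 [leLHS]fgE.
- have := Lp_normB (u n) g (u n.+1); rewrite (Lp_normC (u n) (u n.+1)).
  have gE : Lp_norm (u n.+1 - g) = Lp_norm (u n.+1 - F g).
    by apply: Lp_norm_ae; apply: filterS Fg => x gx ?; rewrite !LfunBE gx.
  by have := step g n; rewrite -gE mulrBl mul1r; lra.
Qed.

End Linfty_theory.

(** * Operators that are linear or bilinear almost everywhere *)

Section ae_linear_operators.
Context (R : realType).
Context d1 (T1 : measurableType d1) (mu : {measure set T1 -> \bar R}).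
Context d2 (T2 : measurableType d2) (nu : {measure set T2 -> \bar R}).
Context (p q : \bar R) (p1 : (1 <= p)%E) (q1 : (1 <= q)%E).
Local Notation X := (LfunType mu p1).
Local Notation Y := (LfunType nu q1).

Definition ae_linear (K : X -> Y) : Prop :=
  forall (a : R) (f g : X), K (a *: f + g) = a *: K f + K g %[ae nu].

Lemma ae_linearB (K : X -> Y) (f g : X) : ae_linear K ->
  K (f - g) = K f - K g %[ae nu].
Proof.
move=> Klin; rewrite -scaleN1r addrC.
apply: filterS (Klin (-1) g f) => x /[apply] ->.
by rewrite LfunBE LfunDE LfunZE; ring.
Qed.

Lemma ae_linearZ (K : X -> Y) (a : R) (f : X) : ae_linear K ->
  K (a *: f) = a *: K f %[ae nu].
Proof.
(* [K 0] vanishes almost everywhere, being [K (0 - 0) = K 0 - K 0]. *)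
move=> Klin; have K0 := ae_linearB 0 0 Klin; rewrite subr0 in K0.
rewrite -[a *: f]addr0; apply: filterS2 K0 (Klin a f 0) => x K0 KE xT.
by rewrite KE// LfunDE K0// LfunBE subrr addr0.
Qed.

(** An operator on functions could separate two representatives of one class; boundedness forbids
    it, since the difference of the images has norm at most [C * 0]. *)
Lemma bounded_linear_ae (K : X -> Y) (f g : X) : bounded_linear K ->
  f = g %[ae mu] -> K f = K g %[ae nu].
Proof.
move=> [Klin [C KC]] /Lp_norm_sub_ae fg0; apply: le0_Lp_norm_sub_ae.
rewrite -(Lp_norm_ae (ae_linearB f g Klin)).
by rewrite (le_trans (KC _))// fg0 mulr0.
Qed.

Definition ae_bilinear (B : X -> X -> Y) : Prop :=
  (forall g, ae_linear (B ^~ g)) /\ (forall f, ae_linear (B f)).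

(** Rescaling by positive upper bounds [s] and [t], instead of by the norms themselves, brings both
    arguments into the unit ball without dividing by a norm that may be 0. *)
Lemma ae_bilinear_norm_le (B : X -> X -> Y) (M s t : R) (f g : X) :
  ae_bilinear B -> (bilinear_norm B <= M%:E)%E -> 0 < s -> 0 < t ->
  Lp_norm f <= s -> Lp_norm g <= t -> Lp_norm (B f g) <= M * (s * t).
Proof.
move=> [Bl Br] BM s0 t0 fs gt.
have BE : B f g = (s * t) *: B (s^-1 *: f) (t^-1 *: g) %[ae nu].
  apply: filterS2 (ae_linearZ s^-1 f (Bl (t^-1 *: g)))
    (ae_linearZ t^-1 g (Br f)).
  move=> x fE gE xT; rewrite LfunZE fE// LfunZE gE// LfunZE.
  by field; rewrite !gt_eqF.
rewrite (Lp_norm_ae BE) Lp_normZ gtr0_norm ?mulr_gt0// mulrC.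
rewrite ler_pM2r ?mulr_gt0// -lee_fin; apply: le_trans BM.
apply: ereal_sup_ubound; exists (s^-1 *: f, t^-1 *: g) => //=.
by split; rewrite Lp_normZ gtr0_norm ?invr_gt0// mulrC ler_pdivrMr// mul1r.
Qed.

Lemma ae_bilinear_norm_le_mul (B : X -> X -> Y) (M t : R) (f g : X) :
  ae_bilinear B -> (bilinear_norm B <= M%:E)%E -> 0 <= M -> 0 < t ->
  Lp_norm g <= t -> Lp_norm (B f g) <= M * t * Lp_norm f.
Proof.
move=> Bbil BM M0 t0 gt; apply/ler_addgt0Pr => e e0.
have c0 : 0 < M * t + 1 by rewrite ltr_wpDl// mulr_ge0// ltW.
(* Enlarging the bound on [f] by [e'] costs [M * t * e' = e - e'], which is below [e]; the added 1
   keeps the denominator positive when [M = 0]. *)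
pose e' := e / (M * t + 1); have e'0 : 0 < e' by rewrite divr_gt0.
have fe' : Lp_norm f <= Lp_norm f + e' by rewrite lerDl ltW.
have s0 : 0 < Lp_norm f + e' by rewrite ltr_wpDl// Lp_norm_ge0.
rewrite (le_trans (ae_bilinear_norm_le Bbil BM s0 t0 fe' gt))//.
have -> : M * ((Lp_norm f + e') * t) =
  M * t * Lp_norm f + (e' * (M * t + 1) - e') by ring.
by rewrite divfK ?gt_eqF// lerD2l lerBlDr lerDl ltW.
Qed.

End ae_linear_operators.

(** * Linearity of iterated integrals *)

Section iterated_integrals.
Context (R : realType) d (T : measurableType d).
Variable mu : {measure set T -> \bar R}.

(** The inner integrals combine only for almost every [x]; integrability of all three inner
    integrals supplies the measurability needed to transfer this to the outer integral. *)
Lemma iterated_Rintegral_linear (a : R) (F G H : T -> T -> R) :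
  (\forall x \ae mu, mu.-integrable setT (EFin \o F x)) ->
  (\forall x \ae mu, mu.-integrable setT (EFin \o G x)) ->
  mu.-integrable setT (fun x => (\int[mu]_y F x y)%:E) ->
  mu.-integrable setT (fun x => (\int[mu]_y G x y)%:E) ->
  mu.-integrable setT (fun x => (\int[mu]_y H x y)%:E) ->
  (forall x y, H x y = a * F x y + G x y) ->
  \int[mu]_x \int[mu]_y H x y =
  a * (\int[mu]_x \int[mu]_y F x y) + \int[mu]_x \int[mu]_y G x y.
Proof.
move=> iF iG iiF iiG iiH HE.
have iiaF : mu.-integrable setT (EFin \o (fun x => a * \int[mu]_y F x y)).
  by have := integrableZl measurableT a iiF; apply: eq_integrable.
rewrite -RintegralZl// -RintegralD//; congr fine.
apply: ae_eq_integral => //.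
- exact: measurable_int iiH.
- exact: measurable_int (integrableD measurableT iiaF iiG).
apply: filterS2 iF iG => x iF iG _ /=; congr EFin.
rewrite -RintegralZl// -RintegralD//.
  by apply: eq_Rintegral => y _; rewrite HE.
by have := integrableZl measurableT a iF; apply: eq_integrable.
Qed.

End iterated_integrals.

(** * Bilinearity of the second Born operator and of its composition with a bounded operator *)

Section K2_theory.
Context (R : realType) (d : nat) (Omega omega : set 'rV[R]_d).
Context (p : \bar R) (p1 : (1 <= p)%E).
Variables (alpha0 : R) (G : 'rV[R]_d -> 'rV[R]_d -> R) (u0 : 'rV[R]_d -> R).

Lemma ext0_linear (a : R) (f g : Linfty omega) y :
  ext0 (a *: f + g) y = a * ext0 f y + ext0 g y.
Proof. by rewrite /ext0; case: ifP => _ //; rewrite mulr0 addr0. Qed.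

(** The integrand is linear in each argument. For fixed arguments, the boundary points where one of
    the three integral formulas fails form a null set. *)
Lemma is_K2_ae_bilinear
    (K2 : Linfty omega -> Linfty omega -> Lboundary Omega p1) :
  is_K2 alpha0 G u0 K2 -> ae_bilinear K2.
Proof.
move=> hK2; split=> [g|f] a f1 f2.
- apply: (@filterS3 _ _ (ae_filter_ringOfSetsType (surf (boundary Omega)))
    _ _ _ _ _) (hK2 (a *: f1 + f2) g) (hK2 f1 g) (hK2 f2 g).
  move=> x [_ iH HE] [iF iiF FE] [iG iiG GE] _.
  rewrite LfunDE LfunZE HE FE GE.
  rewrite (iterated_Rintegral_linear (a := a) iF iG iiF iiG iH); first by ring.
  by move=> y1 y2; rewrite /K2_integrand ext0_linear; ring.
- apply: (@filterS3 _ _ (ae_filter_ringOfSetsType (surf (boundary Omega)))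
    _ _ _ _ _) (hK2 f (a *: f1 + f2)) (hK2 f f1) (hK2 f f2).
  move=> x [_ iH HE] [iF iiF FE] [iG iiG GE] _.
  rewrite LfunDE LfunZE HE FE GE.
  rewrite (iterated_Rintegral_linear (a := a) iF iG iiF iiG iH); first by ring.
  by move=> y1 y2; rewrite /K2_integrand ext0_linear; ring.
Qed.

End K2_theory.

(** Since [B] is bilinear only up to null sets, [K] must first be known to respect equality almost
    everywhere; its own linearity then applies. *)
Lemma bounded_linear_ae_bilinear (R : realType)
    d1 (T1 : measurableType d1) (mu : {measure set T1 -> \bar R})
    d2 (T2 : measurableType d2) (nu : {measure set T2 -> \bar R})
    d3 (T3 : measurableType d3) (rho : {measure set T3 -> \bar R})
    (p q r : \bar R) (p1 : (1 <= p)%E) (q1 : (1 <= q)%E) (r1 : (1 <= r)%E)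
    (K : LfunType nu q1 -> LfunType rho r1)
    (B : LfunType mu p1 -> LfunType mu p1 -> LfunType nu q1) :
  bounded_linear K -> ae_bilinear B -> ae_bilinear (fun f g => K (B f g)).
Proof.
move=> Kbl [Bl Br]; have [Klin _] := Kbl; split=> [g|f] a f1 f2.
- apply: filterS2 (bounded_linear_ae Kbl (Bl g a f1 f2))
    (Klin a (B f1 g) (B f2 g)) => x KBE KE xT.
  by rewrite KBE// KE.
- apply: filterS2 (bounded_linear_ae Kbl (Br f a f1 f2))
    (Klin a (B f f1) (B f f2)) => x KBE KE xT.
  by rewrite KBE// KE.
Qed.

(** * The iteration as a contraction *)

Lemma Linfty_bilinear_iteration (R : realType) d (T : measurableType d)
    (mu : {measure set T -> \bar R})
    (B : LfunType mu (leey 1%E) -> LfunType mu (leey 1%E) ->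
         LfunType mu (leey 1%E))
    (h b : R) (u : nat -> LfunType mu (leey 1%E)) :
  ae_bilinear B -> 0 < h -> 1 < b ->
  (bilinear_norm B <= ((1 - 1 / b) / h)%:E)%E -> Lp_norm (u 1%N) = h ->
  u 0%N = 0 %[ae mu] ->
  (forall n, (1 <= n)%N ->
     u n.+1 = u n - B (u n - u n.-1) (u 1%N) %[ae mu]) ->
  exists g : LfunType mu (leey 1%E),
    [/\ g = u 1%N - B g (u 1%N) %[ae mu],
        forall f : LfunType mu (leey 1%E),
          f = u 1%N - B f (u 1%N) %[ae mu] -> f = g %[ae mu] &
        forall n, Lp_norm (u n - g) <= b * Lp_norm (u n.+1 - u n)].
Proof.
move=> Bbil h0 b1 BM u1h u00 uS; have [Bl _] := Bbil.
have b0 : 0 < b by rewrite (lt_trans ltr01).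
have q0 : 0 <= 1 - 1 / b by rewrite subr_ge0 ler_pdivrMr// mul1r ltW.
have Bq f : Lp_norm (B f (u 1%N)) <= (1 - 1 / b) * Lp_norm f.
  have M0 : 0 <= (1 - 1 / b) / h by rewrite divr_ge0// ltW.
  have := ae_bilinear_norm_le_mul f Bbil BM M0 h0.
  by move=> /(_ (u 1%N)); rewrite u1h lexx => /(_ isT); rewrite divfK ?gt_eqF.
pose F f := u 1%N - B f (u 1%N).
have Fq f g : Lp_norm (F f - F g) <= (1 - 1 / b) * Lp_norm (f - g).
  (* The terms [u 1] cancel, and exchanging the operands absorbs the minus sign in front of [B]. *)
  rewrite Lp_normC (_ : Lp_norm (F g - F f) = Lp_norm (B (f - g) (u 1%N))).
    exact: Bq.
  apply: Lp_norm_ae; apply: filterS (ae_linearB f g (Bl (u 1%N))) => x BE xT.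
  by rewrite BE// !LfunBE; ring.
(* Telescoping: the recursion gives [u_(n+2) = u_(n+1) - B(u_(n+1), u_1) + B(u_n, u_1)], and the
   induction hypothesis turns the first and last terms into [u_1]. At [n = 0] the term [B(u_0, u_1)]
   vanishes almost everywhere by its norm bound. *)
have uF n : u n.+1 = F (u n) %[ae mu].
  elim: n => [|n IH].
    have Bu0 : B (u 0%N) (u 1%N) = (0 : LfunType mu (leey 1%E)) %[ae mu].
      apply: le0_Lp_norm_sub_ae; rewrite subr0 (le_trans (Bq _))//.
      rewrite (Lp_norm_ae (g := 0) u00).
      by rewrite -(scale0r 0) Lp_normZ normr0 mul0r mulr0.
    by apply: filterS Bu0 => x Bx xT; rewrite LfunBE Bx// subr0.
  apply: filterS3 IH (uS n.+1 isT) (ae_linearB (u n.+1) (u n) (Bl (u 1%N))).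
  move=> x IH uE BE xT; rewrite uE// LfunBE BE// !LfunBE.
  by rewrite {1}IH// LfunBE; ring.
have q01 : 0 <= 1 - 1 / b < 1 by rewrite q0 gtrBl divr_gt0.
have [g [gF g_uniq gu]] := Linfty_contraction q01 Fq uF.
exists g; split=> // n.
(* Here [1 - q] is [1 / b], so dividing by it produces the constant [b]. *)
by have := gu n; rewrite subKr -ler_pdivlMl ?divr_gt0// invf_div divr1.
Qed.

Theorem theorem3p2 (R : realType) (d : nat) (hd : (2 <= d)%N)
    (Omega omega : set 'rV[R]_d)
    (hOmega : bounded_domain Omega)
    (homega_closed : closed omega) (homega_sub : omega `<=` Omega)
    (hdist : positive_distance (boundary omega) (boundary Omega))
    (D0 alpha0 beta : R) (hD0 : 0 < D0) (halpha0 : 0 < alpha0)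
    (hbeta : 0 < beta)
    (f : source R d) (u0 : 'rV[R]_d -> R)
    (hu0 : robin_solution D0 alpha0 beta Omega f u0)
    (G : 'rV[R]_d -> 'rV[R]_d -> R)
    (hG : green_function D0 alpha0 beta Omega G)
    (p : \bar R) (p1 : (1 <= p)%E)
    (K1 : Linfty omega -> Lboundary Omega p1)
    (hK1 : is_K1 alpha0 G u0 K1) (hK1_bounded : bounded_linear K1)
    (K2 : Linfty omega -> Linfty omega -> Lboundary Omega p1)
    (hK2 : is_K2 alpha0 G u0 K2)
    (Kreg : R -> Lboundary Omega p1 -> Linfty omega)
    (hKreg_bounded : forall alpha, 0 < alpha -> bounded_linear (Kreg alpha))
    (hKreg : regularizes K1 Kreg)
    (alpha : R) (halpha : 0 < alpha)
    (phi : Lboundary Omega p1)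
    (h : R) (hh : h = Lp_norm (Kreg alpha phi)) (h_gt0 : 0 < h)
    (b : R) (hb : 1 < b)
    (hnorm : (bilinear_norm (fun xi1 xi2 => Kreg alpha (K2 xi1 xi2))
              <= ((1 - 1 / b) / h)%:E)%E)
    (eta : nat -> Linfty omega)
    (heta0 : eta 0%N = 0 %[ae vol omega])
    (heta1 : eta 1%N = Kreg alpha phi %[ae vol omega])
    (heta : forall n, (1 <= n)%N ->
       eta n.+1 = eta n - Kreg alpha (K2 (eta n - eta n.-1) (eta 1%N))
         %[ae vol omega]) :
  let fixed_point (xi : Linfty omega) :=
    xi = eta 1%N - Kreg alpha (K2 xi (eta 1%N)) %[ae vol omega] in
  exists eta_star : Linfty omega,
    [/\ fixed_point eta_star,
        forall xi, fixed_point xi -> xi = eta_star %[ae vol omega] &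
        forall n, Lp_norm (eta n - eta_star)
                  <= b * Lp_norm (eta n.+1 - eta n)].
Proof.
have Bbil := bounded_linear_ae_bilinear (hKreg_bounded _ halpha)
  (is_K2_ae_bilinear hK2).
have eta1h : Lp_norm (eta 1%N) = h by rewrite hh; exact: Lp_norm_ae.
exact: (Linfty_bilinear_iteration Bbil h_gt0 hb hnorm eta1h heta0 heta).
Qed.
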